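(* Let $G$ be a TLRG of bounded degree containing a bounded number of root nodes, and let $T=(\mathcal{L},\mathcal{R})$ be a graph transformation system in which every rule is fast. Then one can decide in constant time the set of direct successors of $G$ (i.e. all $H$ with $G\Rightarrow_{\mathcal{R}}H$), up to isomorphism.
   Context: Fix a label alphabet $\mathcal{L}=(\mathcal{L}_V,\mathcal{L}_E)$ of finite sets. A graph over $\mathcal{L}$ is $G=(V,E,s,t,l,m,p)$ with finite $V,E$, total $s,t:E\to V$, partial node labelling $l:V\to\mathcal{L}_V$, total edge labelling $m:E\to\mathcal{L}_E$, partial rootedness $p:V\to\{0,1\}$ ($p(v)=1$: root node). A TLRG has $l,p$ total. Morphisms preserve sources, targets, edge labels, and node labels and rootedness where defined in the domain. $K$ is a subgraph of $G$ iff $V_K\subseteq V_G$, $E_K\subseteq E_G$, structure and edge labels restrict, $l_K\subseteq l_G$, $p_K\subseteq p_G$. A rule $\langle L\leftarrow K\rightarrow R\rangle$: TLRGs $L,R$, and a graph $K$ that is a subgraph of both. Rule application to a TLRG $G$ via an injective $g:L\to G$ satisfying the dangling condition (no edge outside $g(L)$ incident to $g(V_L\setminus V_K)$): delete images of $L\setminus K$, make $g_V(v)$ unlabelled / of undefined rootedness when $v\in V_K$ is so in $K$; then add disjointly $R\setminus K$ with labels and rootedness, giving such $g_V(v)$ the label $l_R(v)$ / rootedness $p_R(v)$. A GT system has a finite rule set $\mathcal{R}$; $G\Rightarrow_{\mathcal{R}}H$ iff $H$ is obtained (up to isomorphism) by applying some rule of $\mathcal{R}$. A rule is fast iff every connected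 component of $L$ (in the undirected sense) contains a root node. ''Bounded degree'' means every node degree (number of incident edge ends) is bounded by a fixed constant; ''bounded number of root nodes'' similarly; constant time means independent of $G$ (depending only on $T$ and the bounds). Computational model: graphs are stored so that: the set $X$ of nodes with a given label is obtained in $O(|X|)$; a node's degree, in-degree, out-degree in $O(1)$; for a node $v$ and label, the number of nodes reached by outgoing (resp. incoming) edges with that label in $O(1)$ and the set $X$ of such nodes in $O(|X|)$; $|V_G|,|E_G|$ in $O(1)$; the rootedness of a node in $O(1)$; and the set $X$ of root nodes in $O(|X|)$.
   Formalization: The listed O(1) queries cannot read the label of a given node or separate parallel edges, so the claim fails literally; here the model also reads a node's label in O(1), and outgoing/incoming edges with a given label are counted and enumerated per edge, giving edge and node. *)

(* Defs.v *)
From Stdlib Require List.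
From mathcomp Require Import all_boot finmap.

Set Implicit Arguments.
Unset Strict Implicit.
Unset Printing Implicit Defensive.

Local Open Scope fset_scope.
Local Open Scope nat_scope.

(* Nodes and edges are drawn from one countable universe, nat, so that inclusion
   of a subgraph is literal inclusion of finite sets.  Only the values of [src],
   [tgt], [mark] on [edges], and of [lab], [rootedness] on [nodes], matter;
   [None] means "undefined".  Edge labels are required to be defined by
   [is_graph]; the option type admits edgeless graphs over an empty alphabet. *)
Record pregraph (LV LE : finType) := PreGraph {
  nodes : {fset nat};
  edges : {fset nat};
  src : nat -> nat;
  tgt : nat -> nat;
  lab : nat -> option LV;
  mark : nat -> option LE;
  rootedness : nat -> option bool
}.

Section Graphs.
Variables LV LE : finType.
Implicit Types G H K L R : pregraph LV LE.

Definition is_graph G : Prop :=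
  forall e, e \in edges G ->
    [/\ src G e \in nodes G, tgt G e \in nodes G & mark G e <> None].

Definition is_tlrg G : Prop :=
  is_graph G /\
  forall v, v \in nodes G -> lab G v <> None /\ rootedness G v <> None.

Definition subgraph K G : Prop :=
  [/\ nodes K `<=` nodes G,
      edges K `<=` edges G,
      forall e, e \in edges K ->
        [/\ src K e = src G e, tgt K e = tgt G e & mark K e = mark G e],
      forall v a, v \in nodes K -> lab K v = Some a -> lab G v = Some a
    & forall v b, v \in nodes K -> rootedness K v = Some b ->
        rootedness G v = Some b].

Definition morphism G H (gV gE : nat -> nat) : Prop :=
  [/\ forall v, v \in nodes G -> gV v \in nodes H,
      forall e, e \in edges G -> gE e \in edges H,
      forall e, e \in edges G ->
        [/\ src H (gE e) = gV (src G e), tgt H (gE e) = gV (tgt G e)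
          & mark H (gE e) = mark G e],
      forall v a, v \in nodes G -> lab G v = Some a -> lab H (gV v) = Some a
    & forall v b, v \in nodes G -> rootedness G v = Some b ->
        rootedness H (gV v) = Some b].

Definition injective_morphism G H (gV gE : nat -> nat) : Prop :=
  [/\ morphism G H gV gE,
      {in nodes G &, injective gV} & {in edges G &, injective gE}].

(* The last two clauses say that undefinedness is reflected as well. *)
Definition isomorphic G H : Prop :=
  exists gV gE : nat -> nat,
    [/\ injective_morphism G H gV gE,
        forall w, w \in nodes H -> exists2 v, v \in nodes G & gV v = w,
        forall f, f \in edges H -> exists2 e, e \in edges G & gE e = f,
        forall v, v \in nodes G -> lab H (gV v) = lab G v
      & forall v, v \in nodes G -> rootedness H (gV v) = rootedness G v].

Definition root_nodes G : {fset nat} :=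
  [fset v in nodes G | rootedness G v == Some true].
Definition labelled_nodes G (a : LV) : {fset nat} :=
  [fset v in nodes G | lab G v == Some a].

Definition out_edges G v : {fset nat} := [fset e in edges G | src G e == v].
Definition in_edges G v : {fset nat} := [fset e in edges G | tgt G e == v].
Definition out_edges_with G v (b : LE) : {fset nat} :=
  [fset e in out_edges G v | mark G e == Some b].
Definition in_edges_with G v (b : LE) : {fset nat} :=
  [fset e in in_edges G v | mark G e == Some b].

(* A loop contributes two incident edge ends. *)
Definition outdegree G v : nat := #|` out_edges G v|.
Definition indegree G v : nat := #|` in_edges G v|.
Definition degree G v : nat := outdegree G v + indegree G v.

Definition degree_at_most G (d : nat) : Prop :=
  forall v, v \in nodes G -> degree G v <= d.
Definition roots_at_most G (k : nat) : Prop := #|` root_nodes G| <= k.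

Definition adjacent G : rel (nodes G) := fun u v =>
  [exists e : edges G,
     ((src G (val e) == val u) && (tgt G (val e) == val v)) ||
     ((src G (val e) == val v) && (tgt G (val e) == val u))].
Definition component G (v : nodes G) : {set nodes G} :=
  [set u | connect (@adjacent G) v u].

End Graphs.

Record rule (LV LE : finType) := Rule {
  lhs : pregraph LV LE;
  interface : pregraph LV LE;
  rhs : pregraph LV LE;
  lhs_tlrg : is_tlrg lhs;
  rhs_tlrg : is_tlrg rhs;
  interface_graph : is_graph interface;
  interface_lhs : subgraph interface lhs;
  interface_rhs : subgraph interface rhs
}.

(* A graph transformation system over (LV, LE) is given by its finite list of
   rules. *)
Definition gt_system (LV LE : finType) := seq (rule LV LE).

Section Rules.
Variables LV LE : finType.
Implicit Types (r : rule LV LE) (G H : pregraph LV LE) (gV gE : nat -> nat).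

Definition fast r : Prop :=
  forall v : nodes (lhs r),
    exists2 u, u \in component v & rootedness (lhs r) (val u) = Some true.

Definition deleted_nodes r gV : {fset nat} :=
  [fset gV v | v in nodes (lhs r) `\` nodes (interface r)].
Definition deleted_edges r gE : {fset nat} :=
  [fset gE e | e in edges (lhs r) `\` edges (interface r)].

Definition dangling_condition r G gV gE : Prop :=
  forall e, e \in edges G -> e \notin [fset gE f | f in edges (lhs r)] ->
    src G e \notin deleted_nodes r gV /\ tgt G e \notin deleted_nodes r gV.

Definition is_match r G gV gE : Prop :=
  injective_morphism (lhs r) G gV gE /\ dangling_condition r G gV gE.

Definition unlabelled r : {fset nat} :=
  [fset v in nodes (interface r) | lab (interface r) v == None].
Definition unrooted r : {fset nat} :=
  [fset v in nodes (interface r) | rootedness (interface r) v == None].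

Definition deletion r gV gE G : pregraph LV LE := {|
  nodes := nodes G `\` deleted_nodes r gV;
  edges := edges G `\` deleted_edges r gE;
  src := src G;
  tgt := tgt G;
  lab := fun x =>
    if x \in [fset gV v | v in unlabelled r] then None else lab G x;
  mark := mark G;
  rootedness := fun x =>
    if x \in [fset gV v | v in unrooted r] then None else rootedness G x
|}.

Definition preimage (X : {fset nat}) (g : nat -> nat) (x : nat) : option nat :=
  ohead [seq v <- enum_fset X | g v == x].

(* Items of the context graph [D] are encoded in the disjoint union as even
   numbers, items of R \ K as odd ones; [comatch] is the resulting map on the
   nodes of R. *)
Definition comatch r gV (v : nat) : nat :=
  if v \in nodes (interface r) then (gV v).*2 else v.*2.+1.

Definition addition r gV (D : pregraph LV LE) : pregraph LV LE := {|
  nodes := [fset x.*2 | x in nodes D] `|`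
           [fset v.*2.+1 | v in nodes (rhs r) `\` nodes (interface r)];
  edges := [fset x.*2 | x in edges D] `|`
           [fset e.*2.+1 | e in edges (rhs r) `\` edges (interface r)];
  src := fun x =>
    if odd x then comatch r gV (src (rhs r) x./2) else (src D x./2).*2;
  tgt := fun x =>
    if odd x then comatch r gV (tgt (rhs r) x./2) else (tgt D x./2).*2;
  lab := fun x =>
    if odd x then lab (rhs r) x./2
    else if preimage (unlabelled r) gV x./2 is Some v then lab (rhs r) v
    else lab D x./2;
  mark := fun x => if odd x then mark (rhs r) x./2 else mark D x./2;
  rootedness := fun x =>
    if odd x then rootedness (rhs r) x./2
    else if preimage (unrooted r) gV x./2 is Some v then rootedness (rhs r) v
    else rootedness D x./2
|}.

Definition application r gV gE G : pregraph LV LE :=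
  addition r gV (deletion r gV gE G).

Definition direct_successor (T : gt_system LV LE) G H : Prop :=
  exists r gV gE,
    [/\ List.In r T, is_match r G gV gE & isomorphic (application r gV gE G) H].

End Rules.

(* Programs over a stored graph.  They are first-order syntax over node and edge
   variables, so no step can hide a computation in the metalanguage: a stored
   graph is accessed only through the queries below.  [HasLabel] reads the label
   of a known node: the enumeration of all nodes with a given label cannot decide
   this in constant time.  Parallel edges are counted and enumerated separately,
   since a multigraph is not determined by its sets of neighbours. *)

Definition var := nat.

Inductive number_query (LV LE : finType) :=
| Const of nat
| Degree of var
| OutDegree of var
| InDegree of var
| OutCount of var & LE
| InCount of var & LE
| NodeCount
| EdgeCount.

Inductive test (LV LE : finType) :=
| SameNode of var & var
| SameEdge of var & var
| IsRoot of var
| HasLabel of var & LV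
| NumberEq of number_query LV LE & number_query LV LE
| NumberLe of number_query LV LE & number_query LV LE.

Inductive node_query (LV : finType) :=
| Roots
| Labelled of LV.

Inductive direction := Outgoing | Incoming.

Inductive update (LV LE : finType) :=
| DeleteEdge of var
| DeleteNode of var
| SetLabel of var & LV
| SetRoot of var & bool
| AddNode of var & LV & bool      (* binds the variable to the new node *)
| AddEdge of var & var & LE.

(* [ForEdges e y x dir b P] runs [P] once for every edge with label [b] leaving
   (resp. entering) the node [x], with [e] bound to the edge and [y] to the node
   reached by it.  [Output us] adds to the output the graph obtained from the
   stored one by the elementary updates [us]: a graph differing from the stored
   graph in a few places is written down by these differences, since a full copy
   would already take linear time. *)
Inductive program (LV LE : finType) :=
| Skip
| Seq of program LV LE & program LV LE
| If of test LV LE & program LV LE & program LV LE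
| ForNodes of var & node_query LV & program LV LE
| ForEdges of var & var & var & direction & LE & program LV LE
| Output of seq (update LV LE).

Arguments Const {LV LE}.
Arguments Degree {LV LE}.
Arguments OutDegree {LV LE}.
Arguments InDegree {LV LE}.
Arguments OutCount {LV LE}.
Arguments InCount {LV LE}.
Arguments NodeCount {LV LE}.
Arguments EdgeCount {LV LE}.
Arguments SameNode {LV LE}.
Arguments SameEdge {LV LE}.
Arguments IsRoot {LV LE}.
Arguments HasLabel {LV LE}.
Arguments Roots {LV}.
Arguments DeleteEdge {LV LE}.
Arguments DeleteNode {LV LE}.
Arguments SetLabel {LV LE}.
Arguments SetRoot {LV LE}.
Arguments AddNode {LV LE}.
Arguments AddEdge {LV LE}.
Arguments Skip {LV LE}.

Record environment := Env { node_of : var -> nat; edge_of : var -> nat }.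

Definition assign {A : Type} (f : nat -> A) (x : nat) (a : A) : nat -> A :=
  fun y => if y == x then a else f y.

Definition bind_node (rho : environment) (x : var) (v : nat) : environment :=
  Env (assign (node_of rho) x v) (edge_of rho).
Definition bind_edge (rho : environment) (x : var) (e : nat) : environment :=
  Env (node_of rho) (assign (edge_of rho) x e).

(* The order in which a store lists the elements of a set is unspecified. *)
Definition listing_order (ord : {fset nat} -> seq nat) : Prop :=
  forall X, perm_eq (ord X) (enum_fset X).

Section Semantics.
Variables LV LE : finType.
Implicit Types (G : pregraph LV LE) (rho : environment).

Definition number_value G rho (q : number_query LV LE) : nat :=
  match q with
  | Const n => n
  | Degree x => degree G (node_of rho x)
  | OutDegree x => outdegree G (node_of rho x)
  | InDegree x => indegree G (node_of rho x)
  | OutCount x b => #|` out_edges_with G (node_of rho x) b|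
  | InCount x b => #|` in_edges_with G (node_of rho x) b|
  | NodeCount => #|` nodes G|
  | EdgeCount => #|` edges G|
  end.

Definition test_value G rho (b : test LV LE) : bool :=
  match b with
  | SameNode x y => node_of rho x == node_of rho y
  | SameEdge x y => edge_of rho x == edge_of rho y
  | IsRoot x => rootedness G (node_of rho x) == Some true
  | HasLabel x a => lab G (node_of rho x) == Some a
  | NumberEq p q => number_value G rho p == number_value G rho q
  | NumberLe p q => number_value G rho p <= number_value G rho q
  end.

Definition node_set G (q : node_query LV) : {fset nat} :=
  match q with
  | Roots => root_nodes G
  | Labelled a => labelled_nodes G a
  end.

Definition edge_set G (v : nat) (dir : direction) (b : LE) : {fset nat} :=
  match dir with
  | Outgoing => out_edges_with G v b
  | Incoming => in_edges_with G v b
  end.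

Definition reached G (dir : direction) (e : nat) : nat :=
  match dir with Outgoing => tgt G e | Incoming => src G e end.

Definition fresh (X : {fset nat}) : nat := (\max_(x <- enum_fset X) x).+1.

Definition apply_update (st : environment * pregraph LV LE)
    (u : update LV LE) : environment * pregraph LV LE :=
  let: (rho, G) := st in
  match u with
  | DeleteEdge e =>
      (rho, PreGraph (nodes G) (edges G `\ edge_of rho e) (src G) (tgt G)
                     (lab G) (mark G) (rootedness G))
  | DeleteNode x =>
      (rho, PreGraph (nodes G `\ node_of rho x) (edges G) (src G) (tgt G)
                     (lab G) (mark G) (rootedness G))
  | SetLabel x a =>
      (rho, PreGraph (nodes G) (edges G) (src G) (tgt G)
                     (assign (lab G) (node_of rho x) (Some a))
                     (mark G) (rootedness G))
  | SetRoot x b =>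
      (rho, PreGraph (nodes G) (edges G) (src G) (tgt G) (lab G) (mark G)
                     (assign (rootedness G) (node_of rho x) (Some b)))
  | AddNode x a b =>
      let v := fresh (nodes G) in
      (bind_node rho x v,
       PreGraph (v |` nodes G) (edges G) (src G) (tgt G)
                (assign (lab G) v (Some a)) (mark G)
                (assign (rootedness G) v (Some b)))
  | AddEdge x y b =>
      let e := fresh (edges G) in
      (rho, PreGraph (nodes G) (e |` edges G)
                     (assign (src G) e (node_of rho x))
                     (assign (tgt G) e (node_of rho y))
                     (lab G) (assign (mark G) e (Some b)) (rootedness G))
  end.

Definition apply_updates rho G (us : seq (update LV LE)) : pregraph LV LE :=
  (foldl apply_update (rho, G) us).2.

Variable ord : {fset nat} -> seq nat.

Fixpoint output G rho (P : program LV LE) : seq (pregraph LV LE) :=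
  match P with
  | Skip => [::]
  | Seq P1 P2 => output G rho P1 ++ output G rho P2
  | If b P1 P2 =>
      if test_value G rho b then output G rho P1 else output G rho P2
  | ForNodes x q P1 =>
      flatten [seq output G (bind_node rho x v) P1 | v <- ord (node_set G q)]
  | ForEdges e y x dir b P1 =>
      flatten [seq output G (bind_edge (bind_node rho y (reached G dir f)) e f)
                          P1
              | f <- ord (edge_set G (node_of rho x) dir b)]
  | Output us => [:: apply_updates rho G us]
  end.

(* Unit cost per control step, O(1) query, elementary update and element of an
   enumerated set. *)
Fixpoint steps G rho (P : program LV LE) : nat :=
  match P with
  | Skip => 1
  | Seq P1 P2 => (steps G rho P1 + steps G rho P2).+1
  | If b P1 P2 =>
      (if test_value G rho b then steps G rho P1 else steps G rho P2).+1
  | ForNodes x q P1 =>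
      (sumn [seq (steps G (bind_node rho x v) P1).+1
            | v <- ord (node_set G q)]).+1
  | ForEdges e y x dir b P1 =>
      (sumn [seq (steps G (bind_edge (bind_node rho y (reached G dir f)) e f)
                        P1).+1
            | f <- ord (edge_set G (node_of rho x) dir b)]).+1
  | Output us => (size us).+1
  end.

End Semantics.

(* The output lists the set of direct successors up to isomorphism, possibly
   with repetitions. *)
Definition lists_direct_successors (LV LE : finType) (T : gt_system LV LE)
    (G : pregraph LV LE) (Hs : seq (pregraph LV LE)) : Prop :=
  forall H, direct_successor T G H <->
            exists2 H', List.In H' Hs & isomorphic H' H.

(* Main.v *)
Require Import Defs.
From mathcomp Require Import all_boot finmap.

Set Implicit Arguments.
Unset Strict Implicit.
Unset Printing Implicit Defensive.

Local Open Scope fset_scope.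
Local Open Scope nat_scope.

(** Every node of a left-hand side L is reached from a root of L along a walk
whose directions and edge labels are fixed by the rule.  Following all such
walks from all roots of G yields at most k d^n candidates for the image of the
node, among them its image under every match.  Once the nodes are bound, the
candidates for the image of an edge lie among the at most d edges leaving the
image of its source, and the dangling condition says that the image of each
deleted node has the same in- and outdegree in G as the node has in L.  The
updates then performed reproduce the rule application up to isomorphism. *)

(** Fastness removes any search over all nodes of [G]: a component of L without a root could lie
    anywhere in [G], whereas a walk starts at one of the few roots. The walks only propose
    candidates. Soundness needs of them merely that they end at nodes of [G]; every other condition
    of a match is enforced when an edge is bound or is tested on the registers afterwards. A match
    met along several runs only repeats an output, which the listing allows. The program is fixed by
    the rules alone, and the bounds on degree and roots enter only the estimate of its steps. *)

(** * Isomorphisms of stored graphs *)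

Section Isomorphisms.
Variables LV LE : finType.
Implicit Types G H : pregraph LV LE.

Variant preimage_spec (X : {fset nat}) (g : nat -> nat) (x : nat) :
    option nat -> Prop :=
| PreimageSome v of v \in X & g v = x : preimage_spec X g x (Some v)
| PreimageNone of (forall v, v \in X -> g v <> x) : preimage_spec X g x None.

Lemma preimageP X g x : preimage_spec X g x (preimage X g x).
Proof.
rewrite /preimage; case E: [seq _ <- _ | _] => [|v s] /=; constructor.
- move=> v vX gv; have : v \in [seq v <- enum_fset X | g v == x].
    by rewrite mem_filter gv eqxx.
  by rewrite E.
- by have := mem_head v s; rewrite -E mem_filter => /andP[].
- by have := mem_head v s; rewrite -E mem_filter => /andP[/eqP].
Qed.

Lemma inverse_on (X : {fset nat}) (g : nat -> nat) :
  {in X &, injective g} -> exists g', {in X, cancel g g'}.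
Proof.
(* The default 0 is returned only outside the image of [X], where nothing is claimed. *)
move=> g_inj; exists (fun x => odflt 0 (preimage X g x)) => v vX.
by case: preimageP => [u uX /g_inj /= -> //|/(_ v vX)].
Qed.

Lemma isomorphicI G H (gV gE : nat -> nat) :
  (forall v, v \in nodes G -> gV v \in nodes H) ->
  (forall e, e \in edges G -> gE e \in edges H) ->
  (forall e, e \in edges G ->
     [/\ src H (gE e) = gV (src G e), tgt H (gE e) = gV (tgt G e)
       & mark H (gE e) = mark G e]) ->
  {in nodes G &, injective gV} -> {in edges G &, injective gE} ->
  (forall w, w \in nodes H -> exists2 v, v \in nodes G & gV v = w) ->
  (forall f, f \in edges H -> exists2 e, e \in edges G & gE e = f) ->
  (forall v, v \in nodes G -> lab H (gV v) = lab G v) ->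
  (forall v, v \in nodes G -> rootedness H (gV v) = rootedness G v) ->
  isomorphic G H.
Proof.
move=> nodesP edgesP strP injV injE surjV surjE labP rootP.
exists gV, gE; split=> //; split=> //; split=> //.
- by move=> v a vG; rewrite labP.
- by move=> v b vG; rewrite rootP.
Qed.

Lemma isomorphic_trans G1 G2 G3 :
  isomorphic G1 G2 -> isomorphic G2 G3 -> isomorphic G1 G3.
Proof.
move=> [fV [fE [[[fn fe fs _ _] fiV fiE] fsV fsE fl fr]]].
move=> [gV [gE [[[gn ge gs _ _] giV giE] gsV gsE gl gr]]].
apply: (@isomorphicI _ _ (gV \o fV) (gE \o fE)) => /=.
- by move=> v /fn /gn.
- by move=> v /fe /ge.
- by move=> e eG; have [<- <- <-] := fs e eG; apply: gs; apply: fe.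
- by move=> u v uG vG /giV E; apply: fiV => //; apply: E; apply: fn.
- by move=> u v uG vG /giE E; apply: fiE => //; apply: E; apply: fe.
- by move=> w /gsV[v /fsV[u uG <-] <-]; exists u.
- by move=> w /gsE[v /fsE[u uG <-] <-]; exists u.
- by move=> v vG; rewrite gl ?fl //; apply: fn.
- by move=> v vG; rewrite gr ?fr //; apply: fn.
Qed.

(** The map [fV] is inverted on [nodes G] only, and a bare pregraph may have edges whose ends are
    not nodes. [is_graph G] places the ends where the inverse is known. *)
Lemma isomorphic_sym G H : is_graph G -> isomorphic G H -> isomorphic H G.
Proof.
move=> Ggraph [fV [fE [[[fn fe fs _ _] fiV fiE] fsV fsE fl fr]]].
have [gV gVK] := inverse_on fiV; have [gE gEK] := inverse_on fiE.
apply: (@isomorphicI _ _ gV gE).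
- by move=> w /fsV[v vG <-]; rewrite gVK.
- by move=> w /fsE[v vG <-]; rewrite gEK.
- move=> f /fsE[e eG <-]; have [sG tG _] := Ggraph e eG.
  by have [-> -> ->] := fs e eG; rewrite gEK ?gVK.
- by move=> u v /fsV[u' uG <-] /fsV[v' vG <-]; rewrite !gVK // => ->.
- by move=> u v /fsE[u' uG <-] /fsE[v' vG <-]; rewrite !gEK // => ->.
- by move=> v vG; exists (fV v); [apply: fn | apply: gVK].
- by move=> e eG; exists (fE e); [apply: fe | apply: gEK].
- by move=> w /fsV[v vG <-]; rewrite gVK // fl.
- by move=> w /fsV[v vG <-]; rewrite gVK // fr.
Qed.

End Isomorphisms.

(** * Effect of blocks of elementary updates *)

Section Updates.
Variables LV LE : finType.
Implicit Types (G D H : pregraph LV LE) (rho : environment) (r : rule LV LE).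

Lemma fresh_notin (X : {fset nat}) : fresh X \notin X.
Proof.
apply/negP => XX; suff : fresh X < fresh X by rewrite ltnn.
by rewrite {2}/fresh ltnS; apply: (@leq_bigmax_seq _ (enum_fset X) predT id).
Qed.

Lemma assignE (A : Type) (f : nat -> A) x a : assign f x a x = a.
Proof. by rewrite /assign eqxx. Qed.

Lemma assignNE (A : Type) (f : nat -> A) x a y : y != x -> assign f x a y = f y.
Proof. by rewrite /assign => /negPf->. Qed.

(** Induction from the right, since the last write to a cell decides. By injectivity all writes to
    one cell carry the same value, so [vs] may contain repetitions. *)
Lemma foldl_assign_in (A : Type) (g : nat -> nat) (h l : nat -> A) vs v :
  {in vs &, injective g} -> v \in vs ->
  foldl (fun l v => assign l (g v) (h v)) l vs (g v) = h v.
Proof.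
elim/last_ind: vs => [//|vs u IH] g_inj v_in; rewrite -cats1 foldl_cat /=.
rewrite /assign; case: eqP => [E|gvu].
  by congr h; apply/esym/g_inj; rewrite // mem_rcons mem_head.
apply: IH => [x y xs ys|]; first by apply: g_inj; rewrite mem_rcons inE ?xs ?ys orbT.
by move: v_in; rewrite mem_rcons inE => /orP[/eqP E|//]; rewrite E in gvu.
Qed.

Lemma foldl_assign_notin (A : Type) (g : nat -> nat) (h l : nat -> A) vs x :
  (forall v, v \in vs -> g v <> x) ->
  foldl (fun l v => assign l (g v) (h v)) l vs x = l x.
Proof.
elim/last_ind: vs => [//|vs u IH] gx; rewrite -cats1 foldl_cat /=.
rewrite assignNE; first by apply: IH => v vs_v; apply: gx; rewrite mem_rcons inE vs_v orbT.
by apply/eqP=> E; apply: (gx u); rewrite ?mem_rcons ?mem_head.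
Qed.

Lemma foldl_delete_edges rho G es :
  foldl (@apply_update LV LE) (rho, G) [seq DeleteEdge e | e <- es] =
  (rho, PreGraph (nodes G) (edges G `\` [fset edge_of rho e | e in es])
          (src G) (tgt G) (lab G) (mark G) (rootedness G)).
Proof.
elim: es G => [|e es IH] [V E s t l m p] /=.
  congr (_, PreGraph _ _ _ _ _ _ _); apply/fsetP=> x; rewrite !inE.
  by case: imfsetP => [[]|].
rewrite IH /=; congr (_, PreGraph _ _ _ _ _ _ _); apply/fsetP=> x; rewrite !inE.
rewrite andbA; congr (_ && _); rewrite -negb_or; congr (~~ _).
apply/orP/imfsetP => /= [[/imfsetP[f /= fs ->]|/eqP->]|[f]].
- by exists f => //; rewrite inE fs orbT.
- by exists e; rewrite // mem_head.
- rewrite inE => /orP[/eqP->|fs] ->; first by right.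
  by left; apply/imfsetP; exists f.
Qed.

Lemma foldl_delete_nodes rho G vs :
  foldl (@apply_update LV LE) (rho, G) [seq DeleteNode v.*2 | v <- vs] =
  (rho, PreGraph (nodes G `\` [fset node_of rho v.*2 | v in vs]) (edges G)
          (src G) (tgt G) (lab G) (mark G) (rootedness G)).
Proof.
elim: vs G => [|e es IH] [V E s t l m p] /=.
  congr (_, PreGraph _ _ _ _ _ _ _); apply/fsetP=> x; rewrite !inE.
  by case: imfsetP => [[]|].
rewrite IH /=; congr (_, PreGraph _ _ _ _ _ _ _); apply/fsetP=> x; rewrite !inE.
rewrite andbA; congr (_ && _); rewrite -negb_or; congr (~~ _).
apply/orP/imfsetP => /= [[/imfsetP[f /= fs ->]|/eqP->]|[f]].
- by exists f => //; rewrite inE fs orbT.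
- by exists e; rewrite // mem_head.
- rewrite inE => /orP[/eqP->|fs] ->; first by right.
  by left; apply/imfsetP; exists f.
Qed.

(** [pmap] drops undefined values; the hypothesis on [l] ensures that it drops none. *)
Lemma foldl_set_labels rho G (l : nat -> option LV) vs :
  (forall v, v \in vs -> l v <> None) ->
  foldl (@apply_update LV LE) (rho, G)
    (pmap (fun v => omap (SetLabel v.*2) (l v)) vs) =
  (rho, PreGraph (nodes G) (edges G) (src G) (tgt G)
          (foldl (fun l' v => assign l' (node_of rho v.*2) (l v)) (lab G) vs)
          (mark G) (rootedness G)).
Proof.
elim: vs G => [|v vs IH] [V E s t l' m p] lP //=.
have := lP v (mem_head _ _); case lv: (l v) => [a|//] _ /=.
by rewrite IH //= => u us; apply: lP; rewrite inE us orbT.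
Qed.

Lemma foldl_set_roots rho G (l : nat -> option bool) vs :
  (forall v, v \in vs -> l v <> None) ->
  foldl (@apply_update LV LE) (rho, G)
    (pmap (fun v => omap (SetRoot v.*2) (l v)) vs) =
  (rho, PreGraph (nodes G) (edges G) (src G) (tgt G) (lab G) (mark G)
          (foldl (fun l' v => assign l' (node_of rho v.*2) (l v))
             (rootedness G) vs)).
Proof.
elim: vs G => [|v vs IH] [V E s t l' m p] lP //=.
have := lP v (mem_head _ _); case lv: (l v) => [a|//] _ /=.
by rewrite IH //= => u us; apply: lP; rewrite inE us orbT.
Qed.

Definition add_node (R : pregraph LV LE) (v : nat) : option (update LV LE) :=
  if lab R v is Some a then omap (AddNode v.*2.+1 a) (rootedness R v) else None.

(** A fresh name depends on the graph built so far, so the outcome is described by properties only: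
    the new nodes avoid [nodes G], are distinct, and leave the data of old nodes intact. *)
Lemma foldl_add_nodes rho G (R : pregraph LV LE) vs :
  uniq vs -> (forall v, v \in vs -> lab R v <> None /\ rootedness R v <> None) ->
  exists rho' V l p,
    [/\ foldl (@apply_update LV LE) (rho, G) (pmap (add_node R) vs) =
          (rho', PreGraph V (edges G) (src G) (tgt G) l (mark G) p),
        forall x, x \notin [seq v.*2.+1 | v <- vs] ->
          node_of rho' x = node_of rho x,
        forall v, v \in vs ->
          [/\ node_of rho' v.*2.+1 \notin nodes G,
              l (node_of rho' v.*2.+1) = lab R v
            & p (node_of rho' v.*2.+1) = rootedness R v],
        {in vs &, injective (fun v => node_of rho' v.*2.+1)}
      & (forall x, (x \in V) = (x \in nodes G) ||
          (x \in [seq node_of rho' v.*2.+1 | v <- vs])) /\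
        (forall x, x \in nodes G -> l x = lab G x /\ p x = rootedness G x)].
Proof.
elim: vs rho G => [|v vs IH] rho G /=.
  move=> _ _; exists rho, (nodes G), (lab G), (rootedness G); split=> //.
    by case: G.
  by split=> // x; rewrite orbF.
move=> /andP[v_vs vs_uniq] RP; rewrite /add_node.
have [] := RP v (mem_head _ _).
case Ra: (lab R v) => [a|//] _; case Rb: (rootedness R v) => [b|//] _ /=.
set w := fresh (nodes G).
set G1 := PreGraph _ _ _ _ _ _ _.
have [|rho' [V [l [p [-> oldP newP injP [VP presP]]]]]] :=
  IH (bind_node rho v.*2.+1 w) G1 vs_uniq.
  by move=> u us; apply: RP; rewrite inE us orbT.
have w_new : w \notin nodes G := fresh_notin _.
(* The tail never rebinds this register, because [v] does not recur in [vs]. *)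
have rho_v : node_of rho' v.*2.+1 = w.
  rewrite oldP /= ?assignE //; apply/mapP => -[u us [/double_inj E]].
  by rewrite E us in v_vs.
exists rho', V, l, p; split=> //.
- move=> x; rewrite inE negb_or => /andP[xv xs].
  by rewrite oldP //= assignNE.
- move=> u; rewrite inE => /orP[/eqP->|us].
    rewrite rho_v; split=> //.
      by have [|-> _] := presP w; rewrite /= ?inE ?eqxx // assignE.
    by have [|_ ->] := presP w; rewrite /= ?inE ?eqxx // assignE.
  by have [] := newP u us; rewrite /= !inE negb_or => /andP[_ ->].
- move=> x y; rewrite !inE => /orP[/eqP->|xs] /orP[/eqP->|ys] //=.
  + by rewrite rho_v => E; have [] := newP y ys; rewrite -E !inE eqxx.
  + by rewrite rho_v => E; have [] := newP x xs; rewrite E !inE eqxx.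
  + exact: injP.
- split=> [x|x xG]; first by rewrite VP /= !inE rho_v orbCA orbA.
  have [|-> ->] := presP x; first by rewrite /= !inE xG orbT.
  by rewrite /= !assignNE //; apply: contraNneq w_new => <-.
Qed.

(** [AddEdge] binds no register, so [h] is introduced to name the edge created for each [e]. *)
Lemma foldl_add_edges rho G (a b : nat -> nat) (m : nat -> option LE) es :
  uniq es -> (forall e, e \in es -> m e <> None) ->
  exists E s t m' (h : nat -> nat),
    [/\ foldl (@apply_update LV LE) (rho, G)
          (pmap (fun e => omap (AddEdge (a e) (b e)) (m e)) es) =
          (rho, PreGraph (nodes G) E s t (lab G) m' (rootedness G)),
        forall e, e \in es ->
          h e \notin edges G /\
          [/\ s (h e) = node_of rho (a e), t (h e) = node_of rho (b e)
            & m' (h e) = m e],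
        {in es &, injective h},
        forall x, (x \in E) = (x \in edges G) || (x \in [seq h e | e <- es])
      & forall x, x \in edges G ->
          [/\ s x = src G x, t x = tgt G x & m' x = mark G x]].
Proof.
elim: es G => [|e es IH] G /=.
  move=> _ _; exists (edges G), (src G), (tgt G), (mark G), id; split=> //.
    by case: G.
  by move=> x; rewrite orbF.
move=> /andP[e_es es_uniq] mP.
have := mP e (mem_head _ _); case me: (m e) => [c|//] _ /=.
set w := fresh (edges G).
set G1 := PreGraph _ _ _ _ _ _ _.
have [|E [s [t [m' [h [-> newP injP EP presP]]]]]] := IH G1 es_uniq.
  by move=> u us; apply: mP; rewrite inE us orbT.
have w_new : w \notin edges G := fresh_notin _.
have hw u : u \in es -> h u != w.
  by move=> us; apply/eqP=> hu; have [] := newP u us; rewrite hu !inE eqxx.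
have [sw tw mw] : [/\ s w = node_of rho (a e), t w = node_of rho (b e)
    & m' w = m e].
  by have [|-> -> ->] := presP w; rewrite /= ?inE ?eqxx // !assignE me.
exists E, s, t, m', (assign h e w); split=> //.
- move=> u; rewrite inE => /orP[/eqP->|us]; first by rewrite assignE.
  have ue : u != e by apply: contraNneq e_es => <-.
  by have [] := newP u us; rewrite assignNE //= !inE negb_or => /andP[_ ->].
- move=> x y; rewrite !inE /assign.
  case: (eqVneq x e) => [->|xe]; case: (eqVneq y e) => [->|ye] //= xs ys.
  + by move=> E1; have := hw y ys; rewrite -E1 eqxx.
  + by move=> E1; have := hw x xs; rewrite E1 eqxx.
  + exact: injP.
- move=> x; rewrite EP /= !inE assignE orbCA orbA; congr (_ || _).
  suff -> : [seq assign h e w u | u <- es] = [seq h u | u <- es] by [].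
  apply/eq_in_map => u us; rewrite assignNE //.
  by apply: contraNneq e_es => <-.
- move=> x xG; have [|-> -> ->] := presP x; first by rewrite /= !inE xG orbT.
  by rewrite /= !assignNE //; apply: contraNneq w_new => <-.
Qed.

End Updates.

(** * Rule application as a sequence of updates *)

Section Application.
Variables LV LE : finType.
Implicit Types (G D H : pregraph LV LE) (rho : environment) (r : rule LV LE).

(* Register [v.*2] holds the image of the node [v] of L, register [v.*2.+1] the
   copy of the node [v] of R \ K; thus [comatch r id] maps a node of R to its
   register.  Edge registers are the edges of L themselves. *)
Definition rule_updates r : seq (update LV LE) :=
  let: (L, K, R) := (lhs r, interface r, rhs r) in
  [seq DeleteEdge e | e <- enum_fset (edges L `\` edges K)] ++
  [seq DeleteNode v.*2 | v <- enum_fset (nodes L `\` nodes K)] ++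
  pmap (fun v => omap (SetLabel v.*2) (lab R v)) (enum_fset (unlabelled r)) ++
  pmap (fun v => omap (SetRoot v.*2) (rootedness R v))
    (enum_fset (unrooted r)) ++
  pmap (add_node R) (enum_fset (nodes R `\` nodes K)) ++
  pmap (fun e => omap (AddEdge (comatch r id (src R e)) (comatch r id (tgt R e)))
                   (mark R e)) (enum_fset (edges R `\` edges K)).

Lemma application_nodesE r gV gE G x :
  (x \in nodes (application r gV gE G)) =
  if odd x then x./2 \in nodes (rhs r) `\` nodes (interface r)
  else x./2 \in nodes G `\` deleted_nodes r gV.
Proof.
rewrite inE; have := odd_double_half x; case: (odd x) => /= <-.
  rewrite add1n /= uphalf_double; apply/orP/idP => [[]/imfsetP[/= y yin]|yin].
  - by move=> /(congr1 odd); rewrite /= !odd_double.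
  - by move=> [/double_inj ->].
  - by right; apply/imfsetP; exists x./2.
rewrite add0n doubleK; apply/orP/idP => [[]/imfsetP[/= y yin]|yin].
- by move=> /double_inj ->.
- by move=> /(congr1 odd); rewrite /= !odd_double.
- by left; apply/imfsetP; exists x./2.
Qed.

Lemma application_edgesE r gV gE G x :
  (x \in edges (application r gV gE G)) =
  if odd x then x./2 \in edges (rhs r) `\` edges (interface r)
  else x./2 \in edges G `\` deleted_edges r gE.
Proof.
rewrite inE; have := odd_double_half x; case: (odd x) => /= <-.
  rewrite add1n /= uphalf_double; apply/orP/idP => [[]/imfsetP[/= y yin]|yin].
  - by move=> /(congr1 odd); rewrite /= !odd_double.
  - by move=> [/double_inj ->].
  - by right; apply/imfsetP; exists x./2.
rewrite add0n doubleK; apply/orP/idP => [[]/imfsetP[/= y yin]|yin].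
- by move=> /double_inj ->.
- by move=> /(congr1 odd); rewrite /= !odd_double.
- by left; apply/imfsetP; exists x./2.
Qed.

Lemma preserved_node r G gV gE v :
  is_match r G gV gE -> v \in nodes (interface r) ->
  gV v \in nodes G `\` deleted_nodes r gV.
Proof.
move=> [[[gn _ _ _ _] gi _] _] vK; have [KL _ _ _ _] := interface_lhs r.
have vL := fsubsetP KL _ vK; rewrite inE gn // andbT.
apply/negP=> /imfsetP[/= u]; rewrite inE => /andP[uK uL] /gi E.
by rewrite -E // vK in uK.
Qed.

(** A surviving edge outside the image of L is covered by the dangling condition. One inside the
    image stems from an edge of K, whose ends lie in K because K is a graph. *)
Lemma preserved_edge_ends r G gV gE e :
  is_graph G -> is_match r G gV gE -> e \in edges G `\` deleted_edges r gE ->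
  src G e \in nodes G `\` deleted_nodes r gV /\
  tgt G e \in nodes G `\` deleted_nodes r gV.
Proof.
move=> Ggraph gm; rewrite inE => /andP[eD eG].
have [sG tG _] := Ggraph e eG.
case: (boolP (e \in [fset gE f | f in edges (lhs r)])) => [|eL]; last first.
  by have [_ /(_ e eG eL) [sD tD]] := gm; rewrite !inE sG sD tG tD.
move=> /imfsetP[/= f fL Ef]; have fK : f \in edges (interface r).
  by apply: contraNT eD => fK; apply/imfsetP; exists f; rewrite //= inE fK.
have [[[_ _ gs _ _] _ _] _] := gm.
have [_ _ /(_ f fK) [Es Et _] _ _] := interface_lhs r.
have [sK tK _] := interface_graph fK.
by rewrite Ef; have [-> -> _] := gs f fL; rewrite -Es -Et;
  split; apply: preserved_node gm _.
Qed.

Lemma comatch_in_application r G gV gE v :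
  is_match r G gV gE -> v \in nodes (rhs r) ->
  comatch r gV v \in nodes (application r gV gE G).
Proof.
move=> gm vR; rewrite application_nodesE /comatch; case vK: (v \in nodes (interface r)) => /=.
  by rewrite odd_double doubleK; apply: preserved_node gm vK.
by rewrite odd_double /= uphalf_double inE vK vR.
Qed.

(** Needed to reverse an isomorphism that starts at the application. *)
Lemma application_is_graph r G gV gE :
  is_graph G -> is_match r G gV gE -> is_graph (application r gV gE G).
Proof.
move=> Ggraph gm e; rewrite application_edgesE [src _ e]/= [tgt _ e]/= [mark _ e]/=.
case: (odd e) => [|eD].
  rewrite inE => /andP[eK eR]; have [Rgraph _] := rhs_tlrg r.
  by have [sR tR mR] := Rgraph _ eR; split=> //; apply: comatch_in_application.
have [sD tD] := preserved_edge_ends Ggraph gm eD.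
have /Ggraph[_ _ mG] : e./2 \in edges G by move: eD; rewrite inE => /andP[].
by rewrite !application_nodesE /= !odd_double !doubleK.
Qed.

(** The updates keep the names of surviving items and invent fresh ones; the application doubles the
    former and gives odd codes to added items. The isomorphism therefore halves even codes and sends
    an odd code to the fresh item created for its half. *)
Lemma rule_updates_isomorphic r G gV gE rho :
  is_graph G -> is_match r G gV gE ->
  {in nodes (lhs r), forall v, node_of rho v.*2 = gV v} ->
  {in edges (lhs r), forall e, edge_of rho e = gE e} ->
  isomorphic (application r gV gE G) (apply_updates rho G (rule_updates r)).
Proof.
move=> Ggraph gm rhoV rhoE.
have [[_ giV _] _] := gm.
have [KLn KLe _ _ _] := interface_lhs r.
have [KRn KRe _ _ _] := interface_rhs r.
have [Rgraph Rtot] := rhs_tlrg r.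
have rhoK v : v \in nodes (interface r) -> node_of rho v.*2 = gV v.
  by move=> /(fsubsetP KLn); apply: rhoV.
have unlK v : v \in enum_fset (unlabelled r) -> v \in nodes (interface r).
  by rewrite -[_ \in enum_fset _]/(v \in unlabelled r) !inE /= => /andP[].
have unrK v : v \in enum_fset (unrooted r) -> v \in nodes (interface r).
  by rewrite -[_ \in enum_fset _]/(v \in unrooted r) !inE /= => /andP[].
rewrite /apply_updates !foldl_cat foldl_delete_edges foldl_delete_nodes.
rewrite foldl_set_labels; last first.
  by move=> v /unlK /(fsubsetP KRn) /Rtot[].
rewrite foldl_set_roots; last first.
  by move=> v /unrK /(fsubsetP KRn) /Rtot[].
set G1 := PreGraph _ _ _ _ _ _ _.
have [||rho' [V [l [p [-> oldP newP injP [VP presP]]]]]] :=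
  @foldl_add_nodes _ _ rho G1 (rhs r)
    (enum_fset (nodes (rhs r) `\` nodes (interface r))).
- exact: fset_uniq.
- by move=> v; rewrite -[_ \in enum_fset _]/(v \in _ `\` _) inE => /andP[_ /Rtot].
set G2 := PreGraph _ _ _ _ _ _ _.
have [||E [s [t [m [h [-> newE injE EP presE]]]]]] :=
  @foldl_add_edges _ _ rho' G2 (comatch r id \o src (rhs r))
    (comatch r id \o tgt (rhs r)) (mark (rhs r))
    (enum_fset (edges (rhs r) `\` edges (interface r))).
- exact: fset_uniq.
- by move=> e; rewrite -[_ \in enum_fset _]/(e \in _ `\` _) inE => /andP[_ /Rgraph[]].
have nodesG1 : nodes G1 = nodes G `\` deleted_nodes r gV.
  congr (_ `\` _); apply/fsetP=> x; apply/imfsetP/imfsetP => -[/= v vin ->];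
  by exists v => //; move: vin;
     rewrite -?[_ \in enum_fset _]/(v \in _ `\` _) inE => /andP[_ /rhoV].
have edgesG2 : edges G2 = edges G `\` deleted_edges r gE.
  congr (_ `\` _); apply/fsetP=> x; apply/imfsetP/imfsetP => -[/= v vin ->];
  by exists v => //; move: vin;
     rewrite -?[_ \in enum_fset _]/(v \in _ `\` _) inE => /andP[_ /rhoE].
have labG1 v : v \in unlabelled r -> lab G1 (gV v) = lab (rhs r) v.
  move=> vU; rewrite -rhoK ?unlK //=; rewrite foldl_assign_in // => x y xU yU.
  rewrite !rhoK ?unlK //; apply: giV; apply: (fsubsetP KLn); exact: unlK.
have labG1' x : (forall v, v \in unlabelled r -> gV v <> x) ->
    lab G1 x = lab G x.
  move=> xP; rewrite /= foldl_assign_notin // => v vU.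
  by rewrite rhoK ?unlK //; apply: xP.
have rootG1 v : v \in unrooted r -> rootedness G1 (gV v) = rootedness (rhs r) v.
  move=> vU; rewrite -rhoK ?unrK //=; rewrite foldl_assign_in // => x y xU yU.
  rewrite !rhoK ?unrK //; apply: giV; apply: (fsubsetP KLn); exact: unrK.
have rootG1' x : (forall v, v \in unrooted r -> gV v <> x) ->
    rootedness G1 x = rootedness G x.
  move=> xP; rewrite /= foldl_assign_notin // => v vU.
  by rewrite rhoK ?unrK //; apply: xP.
(* Membership in a finite set and in its enumeration are convertible; the facts on new items are
   restated with the former. *)
have newP' v : v \in nodes (rhs r) `\` nodes (interface r) -> _ := newP v.
have newE' e : e \in edges (rhs r) `\` edges (interface r) -> _ := newE e.
pose fV x := if odd x then node_of rho' x else x./2.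
pose fE x := if odd x then h x./2 else x./2.
(* An added edge may end at preserved or at added nodes. Comparing the register of a node of R with
   its code in the application treats both kinds at once. *)
have fV_comatch v : v \in nodes (rhs r) ->
    node_of rho' (comatch r id v) = fV (comatch r gV v).
  rewrite /fV /comatch; case: ifP => vK; rewrite /= odd_double //= doubleK => _.
  rewrite oldP ?rhoK //; apply/mapP => -[u _ /(congr1 odd)].
  by rewrite /= !odd_double.
have oddE x : odd x -> x = x./2.*2.+1.
  by move=> xo; rewrite -{1}(odd_double_half x) xo.
have evenE x : odd x = false -> x = x./2.*2.
  by move=> xo; rewrite -{1}(odd_double_half x) xo.
apply: (isomorphicI (gV := fV) (gE := fE)).
- move=> x; rewrite application_nodesE /fV VP nodesG1.
  case: ifP => [/oddE xo xR|_ ->] //; apply/orP; right.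
  by rewrite {1}xo; apply/mapP; exists x./2.
- move=> x; rewrite application_edgesE /fE EP edgesG2.
  case: ifP => [/oddE xo xR|_ ->] //; apply/orP; right.
  by apply/mapP; exists x./2.
- move=> e; rewrite application_edgesE /fE /= -edgesG2.
  case: ifP => [eo|eo] eP.
    have [_ [-> -> ->]] := newE' _ eP; move: eP; rewrite inE => /andP[_ eR].
    have [sR tR _] := Rgraph _ eR.
    by rewrite /= !fV_comatch.
  by have [-> -> ->] := presE _ eP; rewrite /fV !odd_double !doubleK.
- move=> x y; rewrite !application_nodesE -nodesG1 /fV.
  case: ifP => xo; case: ifP => yo xP yP.
  + rewrite (oddE x xo) (oddE y yo) => /injP E1.
    by congr (_.*2.+1); apply: E1.
  + rewrite (oddE x xo) => E1; have [] := newP' _ xP.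
    by rewrite E1 yP.
  + rewrite (oddE y yo) => E1; have [] := newP' _ yP.
    by rewrite -E1 xP.
  + by rewrite {2}(evenE x xo) {2}(evenE y yo) => ->.
- move=> x y; rewrite !application_edgesE -edgesG2 /fE.
  case: ifP => xo; case: ifP => yo xP yP.
  + by move=> /injE E1; rewrite (oddE x xo) (oddE y yo) E1.
  + by move=> E1; have [] := newE' _ xP; rewrite E1 yP.
  + by move=> E1; have [] := newE' _ yP; rewrite -E1 xP.
  + by rewrite {2}(evenE x xo) {2}(evenE y yo) => ->.
- move=> w; rewrite VP => /orP[wG|/mapP[v vR ->]].
    exists w.*2; last by rewrite /fV odd_double doubleK.
    by rewrite application_nodesE odd_double doubleK -nodesG1.
  exists v.*2.+1; last by rewrite /fV /= odd_double.
  by rewrite application_nodesE /= odd_double /= uphalf_double.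
- move=> w; rewrite EP => /orP[wG|/mapP[v vR ->]].
    exists w.*2; last by rewrite /fE odd_double doubleK.
    by rewrite application_edgesE odd_double doubleK -edgesG2.
  exists v.*2.+1; last by rewrite /fE /= odd_double /= uphalf_double.
  by rewrite application_edgesE /= odd_double /= uphalf_double.
- move=> x; rewrite application_nodesE /fV /= -nodesG1.
  case: ifP => [xo|xo] xP.
    by have [_ <- _] := newP' _ xP; rewrite -oddE.
  have [-> _] := presP _ xP.
  case: preimageP => [v vU <-|xU]; first exact: labG1.
  (* The deletion undefines labels only on images of [unlabelled r], and this node is none of
     them. *)
  rewrite labG1' //; case: imfsetP => // -[/= v vU E1].
  by case: (xU v).
- move=> x; rewrite application_nodesE /fV /= -nodesG1.
  case: ifP => [xo|xo] xP.
    by have [_ _ <-] := newP' _ xP; rewrite -oddE.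
  have [_ ->] := presP _ xP.
  case: preimageP => [v vU <-|xU]; first exact: rootG1.
  rewrite rootG1' //; case: imfsetP => // -[/= v vU E1].
  by case: (xU v).
Qed.

End Application.

(** * Search commands, their runs and their cost *)

Section Commands.
Variables LV LE : finType.
Implicit Types (G L : pregraph LV LE) (rho : environment).

(** In a program each loop encloses everything that depends on its variables. Writing a search as a
    flat list lets its phases be composed by concatenation; [compile] restores the nesting. *)
Inductive command :=
| PickRoot of var
| FollowEdge of var & var & var & direction & LE
| Check of bool & test LV LE.

Fixpoint compile (cs : seq command) (us : seq (update LV LE)) :
    program LV LE :=
  match cs with
  | [::] => Output us
  | PickRoot x :: cs => ForNodes x Roots (compile cs us)
  | FollowEdge e y x dir b :: cs => ForEdges e y x dir b (compile cs us)
  | Check true t :: cs => If t (compile cs us) Skip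
  | Check false t :: cs => If t Skip (compile cs us)
  end.

(** A nondeterministic reading: a run picks one element per loop, so neither the listing order nor
    the other iterations appear in correctness arguments. *)
Fixpoint exec G rho (cs : seq command) rho' : Prop :=
  match cs with
  | [::] => rho' = rho
  | PickRoot x :: cs =>
      exists2 v, v \in root_nodes G & exec G (bind_node rho x v) cs rho'
  | FollowEdge e y x dir b :: cs =>
      exists2 f, f \in edge_set G (node_of rho x) dir b &
        exec G (bind_edge (bind_node rho y (reached G dir f)) e f) cs rho'
  | Check c t :: cs => test_value G rho t = c /\ exec G rho cs rho'
  end.

Lemma In_flatten_map (S : eqType) (A : Type) (F : S -> seq A) (s : seq S) X :
  List.In X (flatten [seq F v | v <- s]) <->
  exists2 v, v \in s & List.In X (F v).
Proof.
elim: s => [|v s IH] /=; first by split=> [|[]].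
rewrite List.in_app_iff IH; split=> [[XF|[u us XF]]|[u]].
- by exists v; rewrite ?mem_head.
- by exists u; rewrite // inE us orbT.
- by rewrite inE => /orP[/eqP->|us XF]; [left | right; exists u].
Qed.

Lemma output_compile ord G rho cs us X : listing_order ord ->
  List.In X (output ord G rho (compile cs us)) <->
  exists2 rho', exec G rho cs rho' & X = apply_updates rho' G us.
Proof.
move=> ordP; elim: cs rho => [|c cs IH] rho /=.
  split=> [[<-|//]|[_ -> ->]]; first by exists rho.
  by left.
have ordE (S : {fset nat}) : ord S =i S := perm_mem (ordP S).
case: c => [x|e y x dir b|[] t] /=.
- rewrite In_flatten_map /=; split=> [[v]|[rho' [v]]].
    by rewrite ordE => vG /IH[rho' ex XE]; exists rho'; first by exists v.
  by move=> vG ex XE; exists v; [rewrite ordE | apply/IH; exists rho'].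
- rewrite In_flatten_map /=; split=> [[v]|[rho' [v]]].
    by rewrite ordE => vG /IH[rho' ex XE]; exists rho'; first by exists v.
  by move=> vG ex XE; exists v; [rewrite ordE | apply/IH; exists rho'].
- case: test_value; last by split=> [|[? []]].
  by rewrite IH; split=> [[rho' ex XE]|[rho' [_ ex] XE]]; exists rho'.
- case: test_value; first by split=> [|[? []]].
  by rewrite IH; split=> [[rho' ex XE]|[rho' [_ ex] XE]]; exists rho'.
Qed.

Lemma leq_sumn_map (S : Type) (F : S -> nat) (s : seq S) n c :
  size s <= n -> (forall v, F v <= c) ->
  sumn [seq (F v).+1 | v <- s] <= n * c.+1.
Proof.
move=> sn Fc; apply: leq_trans (leq_mul sn (leqnn _)).
elim: s {sn} => //= v s IH; rewrite mulSn.
by apply: leq_add; rewrite ?ltnS.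
Qed.

(** The degree bound concerns nodes only, while a register may hold any number; at a number that is
    not a node, a graph has no incident edges. *)
Lemma card_edge_set G d v dir b :
  is_graph G -> degree_at_most G d -> #|` edge_set G v dir b| <= d.
Proof.
move=> Ggraph Gd; case: (boolP (v \in nodes G)) => vG.
  case: dir; apply: leq_trans (Gd v vG); rewrite /degree.
    apply: leq_trans (leq_addr _ _); apply/fsubset_leq_card/fsubsetP=> e.
    by rewrite inE => /andP[].
  apply: leq_trans (leq_addl _ _); apply/fsubset_leq_card/fsubsetP=> e.
  by rewrite inE => /andP[].
suff -> : edge_set G v dir b = fset0 by rewrite cardfs0.
apply/fsetP=> e; rewrite !inE; apply/negP.
case: dir; rewrite !inE /= => /andP[/andP[eG /eqP E] _];
  by have [] := Ggraph e eG; rewrite E (negPf vG).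
Qed.

Lemma steps_compile d k cs us : exists c, forall G ord rho,
  is_graph G -> degree_at_most G d -> roots_at_most G k ->
  listing_order ord -> steps ord G rho (compile cs us) <= c.
Proof.
elim: cs => [|a cs [c IH]] /=; first by exists (size us).+1.
(* One constant serves all kinds of commands: each summand bounds one of them. Of the two extra
   units, one is the control step and the other pays for [Skip] after a failed test. *)
exists (k * c.+1 + d * c.+1 + c).+2 => G ord rho Gg Gd Gk ordP.
have {}IH rho1 := IH G ord rho1 Gg Gd Gk ordP.
have size_ord S : size (ord S) = #|` S| := perm_size (ordP S).
case: a => [x|e y x dir b|[] t] /=.
- rewrite ltnS -addnA leqW //; apply: leq_trans (leq_addr _ _).
  by apply: leq_sumn_map => //; rewrite size_ord.
- rewrite ltnS leqW // addnAC; apply: leq_trans (leq_addl _ _).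
  by apply: leq_sumn_map => //; rewrite size_ord card_edge_set.
- rewrite ltnS; case: test_value => //.
  by apply: leqW; apply: leq_trans (leq_addl _ _).
- rewrite ltnS; case: test_value => //.
  by apply: leqW; apply: leq_trans (leq_addl _ _).
Qed.

Lemma exec_cat G rho cs1 cs2 rho2 :
  exec G rho (cs1 ++ cs2) rho2 <->
  exists2 rho1, exec G rho cs1 rho1 & exec G rho1 cs2 rho2.
Proof.
elim: cs1 rho => [|c cs IH] rho /=.
  by split=> [ex|[_ ->]]; first exists rho.
case: c => [x|e y x dir b|c t].
- split=> [[v vG /IH[rho1]]|[rho1 [v vG ex] ex2]].
    by exists rho1; first exists v.
  by exists v => //; apply/IH; exists rho1.
- split=> [[v vG /IH[rho1]]|[rho1 [v vG ex] ex2]].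
    by exists rho1; first exists v.
  by exists v => //; apply/IH; exists rho1.
- rewrite IH; split=> [[tP [rho1 ex1 ex2]]|[rho1 [tP ex1] ex2]].
    by exists rho1.
  by split=> //; exists rho1.
Qed.

Lemma exec_checks (S : eqType) (c : S -> bool) (t : S -> test LV LE) s
    G rho rho' :
  exec G rho [seq Check (c x) (t x) | x <- s] rho' <->
  rho' = rho /\ {in s, forall x, test_value G rho (t x) = c x}.
Proof.
elim: s => [|x s IH] /=; first by split=> [|[]].
rewrite IH; split=> [[tx [-> ts]]|[-> ts]].
  by split=> // y; rewrite inE => /orP[/eqP->|/ts].
split; first by apply: ts; rewrite mem_head.
by split=> // y ys; apply: ts; rewrite inE ys orbT.
Qed.

(** * Walks given by directions and edge labels *)

Definition step := (direction * LE)%type.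

(** Backward steps make walks exhaust undirected components. A walk records no edges, so the one
    found in L can be replayed in any host graph. *)
Fixpoint reaches G (w : seq step) (u v : nat) : Prop :=
  if w is (dir, b) :: w' then
    exists2 f, f \in edge_set G u dir b & reaches G w' (reached G dir f) v
  else u = v.

Lemma reaches_rcons G w dir b u f :
  f \in edge_set G u dir b ->
  forall u0, reaches G w u0 u ->
  reaches G (rcons w (dir, b)) u0 (reached G dir f).
Proof.
move=> fu; elim: w => [|[dir0 b0] w IH] u0 /=; first by move=> ->; exists f.
by move=> [f0 f0u /IH]; exists f0.
Qed.

Lemma reached_in_nodes G u dir b f :
  is_graph G -> f \in edge_set G u dir b -> reached G dir f \in nodes G.
Proof.
move=> Ggraph; case: dir; rewrite !inE /= => /andP[/andP[fG _] _];
  by have [] := Ggraph f fG.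
Qed.

Lemma morphism_edge_set L G gV gE u dir b f :
  morphism L G gV gE -> f \in edge_set L u dir b ->
  gE f \in edge_set G (gV u) dir b /\
  reached G dir (gE f) = gV (reached L dir f).
Proof.
move=> [_ ge gs _ _]; case: dir; rewrite !inE /= => /andP[/andP[fL /eqP<-] bf];
  by have [-> -> ->] := gs f fL; rewrite ge ?eqxx.
Qed.

Lemma morphism_reaches L G gV gE w u v :
  morphism L G gV gE -> reaches L w u v -> reaches G w (gV u) (gV v).
Proof.
move=> gm; elim: w u => [|[dir b] w IH] u /=; first by move=> ->.
move=> [f /(morphism_edge_set gm)[fG E] /IH].
by rewrite -E; exists (gE f).
Qed.

(* The register [x] itself moves along the walk; only its last value is kept. *)
Definition walk (x : var) (w : seq step) : seq command :=
  PickRoot x :: [seq FollowEdge 0 x x s.1 s.2 | s <- w].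

(** Nothing is said about edge registers: the walk overwrites edge register 0, which may belong to
    an edge of L. *)
Lemma exec_walk_sound G rho x w rho' :
  is_graph G -> exec G rho (walk x w) rho' ->
  node_of rho' x \in nodes G /\
  forall y, y != x -> node_of rho' y = node_of rho y.
Proof.
move=> Ggraph [v]; rewrite !inE /= => /andP[vG _].
have : node_of (bind_node rho x v) x \in nodes G by rewrite /= assignE.
have : forall y, y != x -> node_of (bind_node rho x v) y = node_of rho y.
  by move=> y yx; rewrite /= assignNE.
elim: w (bind_node rho x v) => [|[dir b] w IH] rho1 rho1P xG /=.
  by move=> ->.
move=> [f fP]; apply: IH => [y yx|] /=; first by rewrite assignNE ?rho1P.
by rewrite assignE (reached_in_nodes Ggraph fP).
Qed.

Lemma exec_walk_complete G rho x w u v :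
  u \in root_nodes G -> reaches G w u v ->
  exists2 rho', exec G rho (walk x w) rho' &
    node_of rho' x = v /\ forall y, y != x -> node_of rho' y = node_of rho y.
Proof.
move=> uG.
(* Abstracting [rho1] lets the induction on the walk vary it; only the content of [x] and the
   unchanged other node registers matter. *)
have [rho1 [rho1E xu rho1P]] : exists rho1,
    [/\ rho1 = bind_node rho x u, node_of rho1 x = u
      & forall y, y != x -> node_of rho1 y = node_of rho y].
  exists (bind_node rho x u); split=> [||y yx] //=; first by rewrite assignE.
  by rewrite assignNE.
suff : reaches G w u v -> exists2 rho',
    exec G rho1 [seq FollowEdge 0 x x s.1 s.2 | s <- w] rho' &
    node_of rho' x = v /\ forall y, y != x -> node_of rho' y = node_of rho y.
  by move=> H /H[rho' ex]; exists rho' => //; exists u; rewrite -?rho1E.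
elim: w u rho1 {uG rho1E} xu rho1P => [|[dir b] w IH] u rho1 xu rho1P /=.
  by move=> <-; exists rho1.
move=> [f fP wP].
have [||rho' ex rho'P] :=
  IH _ (bind_edge (bind_node rho1 x (reached G dir f)) 0 f) _ _ wP.
- by rewrite /= assignE.
- by move=> y yx; rewrite /= assignNE ?rho1P.
by exists rho' => //; exists f; rewrite ?xu.
Qed.

(* Node registers of L are even, so register [1] is free as scratch space. *)
Definition match_edge L (e : nat) : seq command :=
  if mark L e is Some b then
    [:: FollowEdge e 1 (src L e).*2 Outgoing b;
        Check true (SameNode 1 (tgt L e).*2)]
  else [::].

Definition match_edges L (es : seq nat) : seq command :=
  flatten [seq match_edge L e | e <- es].

Lemma double_neq1 n : n.*2 != 1.
Proof. by apply/eqP=> /(congr1 odd); rewrite odd_double. Qed.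

Lemma exec_match_edges_sound L G es rho rho' :
  (forall e, e \in es -> mark L e <> None) ->
  exec G rho (match_edges L es) rho' ->
  [/\ forall v, node_of rho' v.*2 = node_of rho v.*2,
      forall e, e \notin es -> edge_of rho' e = edge_of rho e
    & forall e, e \in es ->
        let f := edge_of rho' e in
        f \in edges G /\
        [/\ src G f = node_of rho' (src L e).*2,
            tgt G f = node_of rho' (tgt L e).*2 & mark G f = mark L e]].
Proof.
elim: es rho => [|e es IH] rho mP; first by move=> ->.
rewrite /match_edges /= /match_edge.
have := mP e (mem_head _ _); case me: (mark L e) => [b|//] _ [f].
rewrite /= !inE /= => /andP[/andP[fG /eqP srcf] /eqP markf] [/eqP].
rewrite assignE assignNE ?double_neq1 // => tgtf.
move=> /IH[|nP eP esP]; first by move=> g gs; apply: mP; rewrite inE gs orbT.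
have nP' v : node_of rho' v.*2 = node_of rho v.*2.
  by rewrite nP /= assignNE ?double_neq1.
split=> // [g|g].
  by rewrite inE negb_or => /andP[ge gs]; rewrite eP //= assignNE.
(* If [e] occurs again in the tail, its register is rebound there and the later occurrence
   decides. *)
rewrite inE; case: (boolP (g \in es)) => [/esP //|gs].
rewrite orbF => /eqP ge; rewrite ge in gs *.
by rewrite eP //= assignE; split; rewrite // !nP' srcf tgtf markf.
Qed.

Lemma exec_match_edges_complete L G gV gE es rho :
  is_graph L -> morphism L G gV gE ->
  {in nodes L, forall v, node_of rho v.*2 = gV v} ->
  {subset es <= edges L} ->
  exists2 rho', exec G rho (match_edges L es) rho' &
    [/\ forall v, node_of rho' v.*2 = node_of rho v.*2,
        forall e, e \notin es -> edge_of rho' e = edge_of rho e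
      & forall e, e \in es -> edge_of rho' e = gE e].
Proof.
move=> Lgraph gm; have [_ ge gs _ _] := gm.
elim: es rho => [|e es IH] rho rhoV esL; first by exists rho.
have eL : e \in edges L by apply: esL; rewrite mem_head.
have [sL tL mL] := Lgraph e eL; have [sG tG mG] := gs e eL.
rewrite /match_edges /= /match_edge; case me: (mark L e) mL => [b|//] _.
set rho1 := bind_edge (bind_node rho 1 (tgt G (gE e))) e (gE e).
have rho1V v : node_of rho1 v.*2 = node_of rho v.*2.
  by rewrite /= assignNE ?double_neq1.
have [|g gs'|rho' ex [nP eP esP]] := IH rho1.
- by move=> v vL; rewrite rho1V rhoV.
- by apply: esL; rewrite inE gs' orbT.
exists rho'.
  exists (gE e); first by rewrite /= !inE ge //= sG rhoV // mG me !eqxx.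
  by split=> //; rewrite /test_value rho1V rhoV //= assignE tG eqxx.
split=> [v|g|g]; first by rewrite nP rho1V.
  by rewrite inE negb_or => /andP[ge' gs']; rewrite eP //= assignNE.
rewrite inE; case: (boolP (g \in es)) => [/esP //|gs'].
by rewrite orbF => /eqP ge'; rewrite ge' in gs' *; rewrite eP //= assignE.
Qed.

End Commands.

(** * Finding all matches of a fast rule *)

Section Matching.
Variables LV LE : finType.
Implicit Types (G L : pregraph LV LE) (rho : environment) (r : rule LV LE).

Definition distinct_pairs (X : {fset nat}) : seq (nat * nat) :=
  [seq p <- [seq (u, v) | u <- enum_fset X, v <- enum_fset X] | p.1 != p.2].

Lemma mem_distinct_pairs (X : {fset nat}) u v :
  ((u, v) \in distinct_pairs X) = [&& u != v, u \in X & v \in X].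
Proof.
rewrite mem_filter /=; congr (_ && _); apply/allpairsP/andP => [[[a b]] /=|].
  by case=> aX bX [-> ->].
by move=> [uX vX]; exists (u, v).
Qed.

(** Turns injectivity into finitely many tests for inequality, which [Check false] can execute. *)
Lemma injective_distinct_pairs (X : {fset nat}) (g : nat -> nat) :
  {in X &, injective g} <->
  {in distinct_pairs X, forall p, (g p.1 == g p.2) = false}.
Proof.
split=> [g_inj [u v]|gP u v uX vX gE].
  rewrite mem_distinct_pairs => /and3P[uv uX vX] /=; apply/negP=> /eqP.
  by move=> /(g_inj _ _ uX vX) E; rewrite E eqxx in uv.
apply/eqP; case: (eqVneq u v) => // uv.
by have := gP (u, v); rewrite mem_distinct_pairs uv uX vX /= gE eqxx => /(_ isT).
Qed.

(** Ends and labels of edges are already enforced by [match_edges]. [SameNode 0 0] always succeeds;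
    it fills the branch of an undefined label, which cannot occur in a TLRG. One Boolean test per
    node settles rootedness because it is total in both L and [G]. *)
Definition rule_checks r : seq (command LV LE) :=
  let: (L, D) := (lhs r, nodes (lhs r) `\` nodes (interface r)) in
  [seq Check false (SameNode p.1.*2 p.2.*2) | p <- distinct_pairs (nodes L)] ++
  [seq Check false (SameEdge p.1 p.2) | p <- distinct_pairs (edges L)] ++
  [seq Check true (if lab L v is Some a then HasLabel v.*2 a else SameNode 0 0)
     | v <- enum_fset (nodes L)] ++
  [seq Check (rootedness L v == Some true) (IsRoot v.*2)
     | v <- enum_fset (nodes L)] ++
  [seq Check true (NumberEq (OutDegree v.*2) (Const (outdegree L v)))
     | v <- enum_fset D] ++
  [seq Check true (NumberEq (InDegree v.*2) (Const (indegree L v)))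
     | v <- enum_fset D].

Definition degrees_match r G (gV : nat -> nat) : Prop :=
  forall v, v \in nodes (lhs r) `\` nodes (interface r) ->
    outdegree G (gV v) = outdegree (lhs r) v /\
    indegree G (gV v) = indegree (lhs r) v.

Lemma exec_rule_checks r G rho rho' :
  exec G rho (rule_checks r) rho' <->
  rho' = rho /\
  [/\ {in nodes (lhs r) &, injective (fun v => node_of rho v.*2)},
      {in edges (lhs r) &, injective (edge_of rho)},
      forall v a, v \in nodes (lhs r) -> lab (lhs r) v = Some a ->
        lab G (node_of rho v.*2) = Some a,
      forall v, v \in nodes (lhs r) ->
        (rootedness G (node_of rho v.*2) == Some true) =
        (rootedness (lhs r) v == Some true)
    & degrees_match r G (fun v => node_of rho v.*2)].
Proof.
rewrite /rule_checks; split.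
  rewrite !exec_cat.
  case=> _ /exec_checks[-> /(injective_distinct_pairs _ (fun v => node_of rho v.*2)) injV].
  rewrite exec_cat; case=> _ /exec_checks[-> /injective_distinct_pairs injE].
  rewrite exec_cat; case=> _ /exec_checks[-> labP].
  rewrite exec_cat; case=> _ /exec_checks[-> rootP].
  rewrite exec_cat; case=> _ /exec_checks[-> outP] /exec_checks[-> inP].
  split=> //; split=> //.
    by move=> v a vL la; have := labP v vL; rewrite la => /eqP.
  move=> v vD; split; first by have /eqP := outP v vD.
  by have /eqP := inP v vD.
case=> -> [/(injective_distinct_pairs _ (fun v => node_of rho v.*2)) injV].
move=> /injective_distinct_pairs injE labP rootP degP.
have outP v (vD : v \in _) := (degP v vD).1.
have inP v (vD : v \in _) := (degP v vD).2.
apply/exec_cat; exists rho; first exact/exec_checks.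
apply/exec_cat; exists rho; first exact/exec_checks.
apply/exec_cat; exists rho.
  apply/exec_checks; split=> // v vL.
  case la: (lab (lhs r) v) => [a|] /=; last by rewrite eqxx.
  by rewrite (labP v a) ?eqxx.
apply/exec_cat; exists rho; first exact/exec_checks.
apply/exec_cat; exists rho; apply/exec_checks; split=> // v vD /=.
  by rewrite outP // eqxx.
by rewrite inP // eqxx.
Qed.

(* The end function [src] or [tgt] is abstracted as [sL], [sG]. *)
Lemma card_incident (EL EG : {fset nat}) (gE gV sL sG : nat -> nat) v :
  {in EL &, injective gE} ->
  (forall e, e \in EL -> gE e \in EG) ->
  (forall e, e \in EL -> sG (gE e) = gV (sL e)) ->
  (forall e, e \in EL -> gV (sL e) = gV v -> sL e = v) ->
  #|` [fset e in EG | sG e == gV v]| = #|` [fset e in EL | sL e == v]| <->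
  (forall e, e \in EG -> sG e = gV v -> e \in [fset gE f | f in EL]).
Proof.
move=> injE ge gs inj_v.
set IG := [fset e in EG | _]; set IL := [fset e in EL | _].
(* The edges at [v] embed into those at its image, and an inclusion of finite sets is an equality
   exactly when their sizes agree. *)
have sub : [fset gE f | f in IL] `<=` IG.
  apply/fsubsetP=> e /imfsetP[/= f]; rewrite !inE => /andP[fL /eqP fv] ->.
  by rewrite /= ge // gs // fv eqxx.
have card_im : #|` [fset gE f | f in IL]| = #|` IL|.
  by apply: card_in_imfset => e f; rewrite !inE => /andP[eL _] /andP[fL _]; apply: injE.
rewrite -card_im; split=> [Ecard e eG ev|H].
  have : e \in IG by rewrite !inE eG ev eqxx.
  have /(_ e) <- := fsubset_cardP (esym Ecard) sub.
  move=> /imfsetP[/= f]; rewrite !inE => /andP[fL _] ->.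
  by apply/imfsetP; exists f.
apply/esym/eqP; rewrite eqn_leq fsubset_leq_card //=.
apply/fsubset_leq_card/fsubsetP=> e; rewrite !inE => /andP[eG /eqP ev].
have /imfsetP[/= f fL Ef] := H e eG ev; rewrite Ef; apply/imfsetP; exists f => //.
by rewrite !inE fL; apply/eqP/inj_v; rewrite // -gs // -Ef.
Qed.

(** Replaces a condition on all edges of [G] by two constant-time queries per deleted node. Sources
    and targets are counted separately, so a loop is handled once on each side. *)
Lemma dangling_degrees r G gV gE :
  injective_morphism (lhs r) G gV gE ->
  dangling_condition r G gV gE <-> degrees_match r G gV.
Proof.
move=> [[_ ge gs _ _] giV giE]; have [Lgraph _] := lhs_tlrg r.
have cardS v (vL : v \in nodes (lhs r)) :
    outdegree G (gV v) = outdegree (lhs r) v <->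
    (forall e, e \in edges G -> src G e = gV v ->
       e \in [fset gE f | f in edges (lhs r)]).
  apply: card_incident => // e eL; first by have [] := gs e eL.
  by have [sL _ _] := Lgraph e eL; move/giV; apply.
have cardT v (vL : v \in nodes (lhs r)) :
    indegree G (gV v) = indegree (lhs r) v <->
    (forall e, e \in edges G -> tgt G e = gV v ->
       e \in [fset gE f | f in edges (lhs r)]).
  apply: card_incident => // e eL; first by have [] := gs e eL.
  by have [_ tL _] := Lgraph e eL; move/giV; apply.
split=> [dang v vD|deg e eG eL].
  have vL : v \in nodes (lhs r) by move: vD; rewrite inE => /andP[].
  have gvD : gV v \in deleted_nodes r gV by apply/imfsetP; exists v.
  split; [apply/cardS | apply/cardT] => // e eG ev; apply: contraLR gvD => eL.
    by have [+ _] := dang e eG eL; rewrite ev.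
  by have [_ +] := dang e eG eL; rewrite ev.
split; apply: contra eL => /imfsetP[/= v vD ev]; have [outv inv] := deg v vD.
  by apply: (proj1 (cardS v _)) => //; move: vD; rewrite inE => /andP[].
by apply: (proj1 (cardT v _)) => //; move: vD; rewrite inE => /andP[].
Qed.

Lemma fast_reaches r v : fast r -> v \in nodes (lhs r) ->
  exists u w, u \in root_nodes (lhs r) /\ reaches (lhs r) w u v.
Proof.
move=> r_fast vL; have [u] := r_fast [` vL].
rewrite inE => /connectP[p pP ->] uroot; exists (val (last [` vL] p)).
(* The path leads from [v] to the root but the walk must start at the root. The induction on the
   path hence appends each edge, traversed backwards, at the end of the walk. *)
suff [w wP] : exists w, reaches (lhs r) w (val (last [` vL] p)) (val [` vL]).
  by exists w; rewrite !inE /= uroot eqxx andbT; split=> //; apply: valP.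
elim: p [` vL] pP {uroot} => [|y p IH] x /=; first by exists [::].
move=> /andP[/existsP[e] xy /IH[w wP]].
have [Lgraph _] := lhs_tlrg r; have [_ _] := Lgraph _ (valP e).
case me: (mark (lhs r) (val e)) => [b|//] _.
case/orP: xy => /andP[/eqP Es /eqP Et].
  have eP : val e \in edge_set (lhs r) (val y) Incoming b.
    by rewrite !inE /= me Et !eqxx !andbT; apply: valP.
  by exists (rcons w (Incoming, b)); rewrite -Es; apply: reaches_rcons eP _ wP.
have eP : val e \in edge_set (lhs r) (val y) Outgoing b.
  by rewrite !inE /= me Es !eqxx !andbT; apply: valP.
by exists (rcons w (Outgoing, b)); rewrite -Et; apply: reaches_rcons eP _ wP.
Qed.

Lemma morphism_root L G gV gE u :
  morphism L G gV gE -> u \in root_nodes L -> gV u \in root_nodes G.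
Proof.
move=> [gn _ _ _ groot]; rewrite !inE /= => /andP[uL /eqP ur].
by rewrite gn //= (groot u true) ?eqxx.
Qed.

(** The two halves are deliberately asymmetric: every run yields nodes of [G], perhaps wrong ones,
    and for every morphism some run yields exactly its values. *)
Lemma bind_nodes r (vs : seq nat) : fast r -> {subset vs <= nodes (lhs r)} ->
  exists cs : seq (command LV LE),
    (forall G rho rho', is_graph G -> exec G rho cs rho' ->
       {in vs, forall v, node_of rho' v.*2 \in nodes G}) /\
    (forall G gV gE rho, morphism (lhs r) G gV gE ->
       exists2 rho', exec G rho cs rho' &
         {in vs, forall v, node_of rho' v.*2 = gV v}).
Proof.
move=> r_fast; elim: vs => [|v vs IH] vsL.
  by exists [::]; split=> // G gV gE rho _; exists rho.
have [|cs [csS csC]] := IH; first by move=> u us; apply: vsL; rewrite inE us orbT.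
have [u [w [uroot wP]]] := fast_reaches r_fast (vsL v (mem_head _ _)).
exists (cs ++ walk LV v.*2 w); split=> [G rho rho' Gg|G gV gE rho gm].
  move=> /exec_cat[rho1 /(csS _ _ _ Gg) rho1P /(exec_walk_sound Gg)[vG oldP]] x.
  rewrite inE; case: (eqVneq x v) => [->|xv] //= /rho1P xG.
  by rewrite oldP // (inj_eq double_inj).
have [rho1 ex1 rho1P] := csC G gV gE rho gm.
have [rho' ex [vP oldP]] := @exec_walk_complete _ _ G rho1 v.*2 w _ _
  (morphism_root gm uroot) (morphism_reaches gm wP).
exists rho'; first by apply/exec_cat; exists rho1.
move=> x; rewrite inE; case: (eqVneq x v) => [->|xv] //= xs.
by rewrite oldP ?rho1P // (inj_eq double_inj).
Qed.

Lemma match_commands r : fast r -> exists cs : seq (command LV LE),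
  (forall G rho rho', is_tlrg G -> exec G rho cs rho' ->
     is_match r G (fun v => node_of rho' v.*2) (edge_of rho')) /\
  (forall G rho gV gE, is_tlrg G -> is_match r G gV gE ->
     exists2 rho', exec G rho cs rho' &
       {in nodes (lhs r), forall v, node_of rho' v.*2 = gV v} /\
       {in edges (lhs r), forall e, edge_of rho' e = gE e}).
Proof.
move=> r_fast.
have [cs [csS csC]] :=
  @bind_nodes r (enum_fset (nodes (lhs r))) r_fast (fun v vL => vL).
have [Lgraph Ltot] := lhs_tlrg r.
(* Walks come first: they spoil edge register 0, and an edge is sought from the already bound image
   of its source. *)
exists (cs ++ match_edges (lhs r) (enum_fset (edges (lhs r))) ++ rule_checks r).
split=> [G rho rho' [Ggraph Gtot]|G rho gV gE [Ggraph Gtot] gm].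
  move=> /exec_cat[rho1 /(csS _ _ _ Ggraph) rho1P].
  move=> /exec_cat[rho2 /exec_match_edges_sound[|nP _ eP]].
    by move=> e eL; have [] := Lgraph e eL.
  move=> /exec_rule_checks[-> [injV injE labP rootP degP]].
  have inj : injective_morphism (lhs r) G (fun v => node_of rho2 v.*2)
      (edge_of rho2).
    have nodesP v : v \in nodes (lhs r) -> node_of rho2 v.*2 \in nodes G.
      by move=> vL; rewrite nP; apply: rho1P.
    split=> //; split=> //.
    - by move=> e eL; have [] := eP e eL.
    - by move=> e eL; have [_] := eP e eL.
    (* The test compares with [Some true] only; at the image of a non-root, totality of rootedness
       in [G] leaves [Some false]. *)
    - move=> v b vL vb; have := rootP v vL; rewrite vb.
      have [_] := Gtot _ (nodesP v vL).
      by case: (rootedness G _) => [[]|] //; case: b {vb} => // _ /eqP.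
  by split=> //; apply/(dangling_degrees inj).
have [inj dang] := gm; have [gmor injV injE] := inj.
have [rho1 ex1 rho1P] := csC G gV gE rho gmor.
have [|rho2 ex2 [nP _ eP]] := @exec_match_edges_complete _ _ (lhs r) G gV gE
  (enum_fset (edges (lhs r))) rho1 Lgraph gmor rho1P; first by [].
have rho2P v : v \in nodes (lhs r) -> node_of rho2 v.*2 = gV v.
  by move=> vL; rewrite nP rho1P.
exists rho2; last by split=> // e eL; apply: eP.
apply/exec_cat; exists rho1 => //; apply/exec_cat; exists rho2 => //.
apply/exec_rule_checks; split=> //.
have [gn ge gs glab groot] := gmor; split.
- by move=> u v uL vL; rewrite !rho2P //; apply: injV.
- by move=> e f eL fL; rewrite !eP //; apply: injE.
- by move=> v a vL va; rewrite rho2P // (glab v a).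
- move=> v vL; rewrite rho2P //; have [_] := Ltot v vL.
  by case vb: (rootedness (lhs r) v) => [b|//] _; rewrite (groot v b).
- move=> v vD; have vL : v \in nodes (lhs r) by move: vD; rewrite inE => /andP[].
  by rewrite rho2P //; apply: (proj1 (dangling_degrees inj) dang).
Qed.

Lemma rule_program r : fast r -> exists P : program LV LE,
  (forall G ord rho, is_tlrg G -> listing_order ord ->
     lists_direct_successors [:: r] G (output ord G rho P)) /\
  (forall d k, exists c, forall G ord rho,
     is_graph G -> degree_at_most G d -> roots_at_most G k ->
     listing_order ord -> steps ord G rho P <= c).
Proof.
move=> /match_commands[cs [csS csC]].
exists (compile cs (rule_updates r)); split=> [G ord rho GT ordP H|d k].
  2: exact: steps_compile.
have [Ggraph _] := GT; split=> [[_ [gV [gE [[<-|//] gm appH]]]]|[H']].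
  have [rho' ex [rho'V rho'E]] := csC G rho gV gE GT gm.
  exists (apply_updates rho' G (rule_updates r)).
    by apply/(output_compile _ _ _ _ _ ordP); exists rho'.
  apply: isomorphic_trans appH; apply: isomorphic_sym.
    exact: application_is_graph.
  exact: rule_updates_isomorphic.
move=> /(output_compile _ _ _ _ _ ordP)[rho' ex ->] H'H.
have gm := csS G rho rho' GT ex.
exists r, (fun v => node_of rho' v.*2), (edge_of rho'); split=> //; first by left.
by apply: isomorphic_trans H'H; apply: rule_updates_isomorphic.
Qed.

End Matching.

(* The registers [rho] initially hold arbitrary values. *)
Theorem mainTheorem5 (LV LE : finType) (T : gt_system LV LE)
    (Tfast : forall r : rule LV LE, List.In r T -> fast r) :
  exists P : program LV LE,
    forall d k : nat, exists c : nat,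
      forall G : pregraph LV LE,
        is_tlrg G -> degree_at_most G d -> roots_at_most G k ->
        forall (ord : {fset nat} -> seq nat) (rho : environment),
          listing_order ord ->
          lists_direct_successors T G (output ord G rho P) /\
          (steps ord G rho P <= c)%N.
Proof.
elim: T Tfast => [|r T IH] Tfast.
  exists Skip => d k; exists 1 => G _ _ _ ord rho _; split=> // H.
  by split=> [[r [_ [_ [[]]]]]|[]].
have [P2 P2P] := IH (fun s sT => Tfast s (or_intror sT)).
have [P1 [P1P P1steps]] := rule_program (Tfast r (or_introl erefl)).
(* Two rules may yield the same successor; the concatenated outputs then repeat it, which is
   allowed. *)
exists (Seq P1 P2) => d k.
have [c1 c1P] := P1steps d k; have [c2 c2P] := P2P d k.
exists (c1 + c2).+1 => G GT Gd Gk ord rho ordP; have [Ggraph _] := GT.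
have [P2out P2steps] := c2P G GT Gd Gk ord rho ordP.
split; last by rewrite /= ltnS leq_add // c1P.
move=> H; rewrite /=; split=> [[s [gV [gE [[sr|sT] gm appH]]]]|[H']].
- have [|H' H'in H'H] := proj1 (P1P G ord rho GT ordP H).
    by exists s, gV, gE; split=> //; left.
  by exists H' => //; apply/List.in_app_iff; left.
- have [|H' H'in H'H] := proj1 (P2out H); first by exists s, gV, gE.
  by exists H' => //; apply/List.in_app_iff; right.
move=> /List.in_app_iff[]H'in H'H.
  have [|s [gV [gE [[sr|//] gm appH]]]] := proj2 (P1P G ord rho GT ordP H).
    by exists H'.
  by exists s, gV, gE; split=> //; left.
have [|s [gV [gE [sT gm appH]]]] := proj2 (P2out H); first by exists H'.
by exists s, gV, gE; split=> //; right.
Qed.
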